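(* Let $m \ge 1$ be the number of qubits. (1) For every integer $k\ge 1$ and every symmetric matrix $R \in \mathbb{Z}_{2^k}^{m\times m}$, the matrix $\tau_R^{(k)}$ belongs to $\mathcal{C}_d^{(k)}$. (2) Every two-local diagonal unitary on $m$ qubits that lies in the Clifford hierarchy (i.e. in $\mathcal{C}^{(j)}$ for some $j\ge 1$) equals, up to a global phase (a complex scalar of modulus $1$), $\tau_R^{(k)}$ for some integer $k\ge 1$ and some symmetric $R\in\mathbb{Z}_{2^k}^{m\times m}$.
   Context: Let $N=2^m$, and index the standard basis $e_v=|v\rangle$ of $\mathbb{C}^N=(\mathbb{C}^2)^{\otimes m}$ by row vectors $v\in\{0,1\}^m=\mathbb{Z}_2^m$. Let $X=\begin{bmatrix}0&1\\1&0\end{bmatrix}$, $Z=\begin{bmatrix}1&0\\0&-1\end{bmatrix}$, $\imath=\sqrt{-1}$. For $a,b\in\mathbb{Z}_2^m$ put $D(a,b)=X^{a_1}Z^{b_1}\otimes\cdots\otimes X^{a_m}Z^{b_m}$. The Pauli (Heisenberg-Weyl) group is $HW_N=\{\imath^{\kappa}D(a,b): \kappa\in\mathbb{Z}_4,\ a,b\in\mathbb{Z}_2^m\}$. Clifford hierarchy: $\mathcal{C}^{(1)}=HW_N$ and, for $k>1$, $\mathcal{C}^{(k)}=\{U\in\mathbb{U}_N: U D(a,b)U^\dagger\in\mathcal{C}^{(k-1)}\text{ for all } a,b \in\mathbb{Z}_2^m\}$, where $\mathbb{U}_N$ is the group of $N\times N$ unitary matrices. $\mathcal{C}_d^{(k)}$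 denotes the set of diagonal matrices (in the basis $(e_v)$) in $\mathcal{C}^{(k)}$. For $k\ge1$, let $\mathbb{Z}_{2^k}$ be the ring of integers modulo $2^k$ and $\xi=\exp(2\pi\imath/2^k)$. For symmetric $R\in\mathbb{Z}_{2^k}^{m\times m}$, $\tau_R^{(k)}=\sum_{v\in\mathbb{Z}_2^m}\xi^{vRv^T \bmod 2^k}|v\rangle\langle v|$, where the entries of $v$ are regarded as the integers $0,1$. A diagonal unitary on $m$ qubits is two-local if it is a tensor product of single-qubit and two-qubit diagonal unitaries, i.e. the $m$ qubits can be partitioned into blocks of size $1$ or $2$ such that the unitary is the tensor product of diagonal unitaries each acting on one block. *)

(* Defs.v *)
From HB Require Import structures.
From mathcomp Require Import all_boot all_order all_algebra.
From mathcomp Require Import spectral complex.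
From mathcomp Require Import reals trigo.

Set Implicit Arguments.
Unset Strict Implicit.
Unset Printing Implicit Defensive.

Import Order.TTheory GRing.Theory Num.Theory.

Local Open Scope ring_scope.
Local Open Scope complex_scope.
Local Open Scope sesquilinear_scope.

(* The standard basis of (C^2)^{\otimes m} is indexed by the row vectors of
   Z_2^m: the basis vector |v> has position enum_rank v. *)
Notation qdim m := #|{: 'rV['Z_2]_m}|.

Lemma qdimE (m : nat) : qdim m = (2 ^ m)%N.
Proof. by rewrite card_mx card_ord mul1n. Qed.

Definition label (m : nat) (i : 'I_(qdim m)) : 'rV['Z_2]_m := enum_val i.

Notation qmx R m := 'M[complex R]_(qdim m).

Section Qubits.
Variable R : realType.
Local Notation C := (complex R).

Definition pauliX : 'M[C]_2 := \matrix_(i < 2, j < 2) (i != j)%:R.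

Definition pauliZ : 'M[C]_2 :=
  \matrix_(i < 2, j < 2) (if i == j then (-1) ^+ i else 0).

(* The <v|_|w> entry of A_1 \otimes ... \otimes A_m is the product of the
   entries A_l (v_l, w_l). *)
Definition tensor_qubits (m : nat) (A : 'I_m -> 'M[C]_2) : qmx R m :=
  \matrix_(i, j) \prod_(l < m) A l (label i 0 l) (label j 0 l).

Definition D (m : nat) (a b : 'rV['Z_2]_m) : qmx R m :=
  tensor_qubits (fun l => pauliX ^+ a 0 l *m pauliZ ^+ b 0 l).

Definition HW (m : nat) (U : qmx R m) : Prop :=
  exists (kappa : 'Z_4) (a b : 'rV['Z_2]_m), U = 'i%C ^+ kappa *: D a b.

(* Levels start at 1; level 0 is a dummy, empty level, never used by the
   recursion since level 1 is HW. *)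
Fixpoint clifford (m k : nat) (U : qmx R m) : Prop :=
  match k with
  | 0 => False
  | 1 => HW U
  | k'.+1 => U \is unitarymx /\
      forall a b : 'rV['Z_2]_m, clifford k' (U *m D a b *m U^t*)
  end.

Definition clifford_diag (m k : nat) (U : qmx R m) : Prop :=
  clifford k U /\ is_diag_mx U.

(* exp (2 pi i / 2^k) *)
Definition xi (k : nat) : C :=
  cos (2 * pi / 2 ^+ k) +i* sin (2 * pi / 2 ^+ k).

(* 'Z_n is the ring of integers modulo n only for n >= 2, hence the forms below
   are meaningful for k >= 1. *)
Definition qform (m k : nat) (S : 'M['Z_(2 ^ k)]_m) (v : 'rV['Z_2]_m) :
    'Z_(2 ^ k) :=
  let w := map_mx (fun x : 'Z_2 => (x : nat)%:R : 'Z_(2 ^ k)) v in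
  (w *m S *m w^T) 0 0.

Definition tau (m k : nat) (S : 'M['Z_(2 ^ k)]_m) : qmx R m :=
  \sum_(v : 'rV['Z_2]_m)
    xi k ^+ qform S v *: delta_mx (enum_rank v) (enum_rank v).

(* The coordinates of v on the qubits of B, listed in increasing order. *)
Definition restrict (m : nat) (B : {set 'I_m}) (v : 'rV['Z_2]_m) :
    'rV['Z_2]_#|B| :=
  \row_(l < #|B|) v 0 (enum_val l).

Definition tensor_blocks (m : nat) (P : {set {set 'I_m}})
    (W : forall B : {set 'I_m}, qmx R #|B|) : qmx R m :=
  \matrix_(i, j) \prod_(B in P)
    W B (enum_rank (restrict B (label i)))
        (enum_rank (restrict B (label j))).

Definition two_local_diag_unitary (m : nat) (U : qmx R m) : Prop :=
  exists (P : {set {set 'I_m}}) (W : forall B : {set 'I_m}, qmx R #|B|),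
    [/\ partition P [set: 'I_m],
        {in P, forall B : {set 'I_m}, #|B| = 1%N \/ #|B| = 2%N},
        {in P, forall B : {set 'I_m}, W B \is unitarymx /\ is_diag_mx (W B)}
      & U = tensor_blocks P W].

End Qubits.

(* Main.v *)
(* Conjugating D(a, b) by diag(f) X^c gives, up to a sign character, the matrix
   diag(v |-> f v / f (v + a)) X^a. (1) If f = xi_k^q for a symmetric integer
   quadratic form q, then q v - q (v + a) is a constant plus twice such a form,
   so f v / f (v + a) is a phase times xi_(k-1) to a quadratic form; induct
   on k. (2) If all the ratios f v / f (v + a) have a constant 2^r-th power,
   swapping v and v + a shows that this power is 1 or -1; hence membership in
   the hierarchy forces f v / f 0 to be a 2^r-th root of unity. Two-locality
   makes f v / f 0 the product of its values at the labels supported on one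
   block, and on at most two bits every phase function vanishing at 0 is
   alpha x + beta y + gamma x y. *)
Require Import Defs.
From mathcomp Require Import all_boot all_order all_algebra.
From mathcomp Require Import spectral complex.
From mathcomp Require Import reals trigo.
From mathcomp Require Import ring.

Set Implicit Arguments.
Unset Strict Implicit.
Unset Printing Implicit Defensive.

Import Order.TTheory GRing.Theory Num.Theory.

Local Open Scope ring_scope.

Section DiagonalClifford.
Variable R : realType.
Local Notation C := (complex R).

(** * Roots of unity of 2-power order *)

Lemma xi0 : xi R 0 = 1.
Proof.
rewrite /xi expr0 divr1 mulr_natl cos2pi sin2pi; exact/eqP.
Qed.

Lemma xiS_sqr k : xi R k.+1 ^+ 2 = xi R k.
Proof.
have -> : xi R k = (cos (2 * pi / 2 ^+ k.+1 *+ 2) +i*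
                    sin (2 * pi / 2 ^+ k.+1 *+ 2))%C.
  by rewrite /xi; congr (cos _ +i* sin _)%C; rewrite exprS; field;
    rewrite expf_neq0 ?pnatr_eq0.
rewrite cos_mulr2n sin_mulr2n /xi expr2; set x := _ / _.
apply/eqP; rewrite eq_complex /=; apply/andP; split; apply/eqP; last by ring.
by rewrite -!expr2 sin2cos2; ring.
Qed.

Lemma xi1 : xi R 1 = -1.
Proof.
rewrite /xi expr1 mulrC mulKf ?pnatr_eq0 // cospi sinpi.
by apply/eqP; rewrite eq_complex /= oppr0 !eqxx.
Qed.

Lemma xi2 : xi R 2 = 'i%C.
Proof.
have -> : xi R 2 = (cos (pi / 2) +i* sin (pi / 2))%C.
  by rewrite /xi; congr (cos _ +i* sin _)%C; field.
by rewrite cos_pihalf sin_pihalf.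
Qed.

Lemma xiX_pow2 k l : xi R (k + l) ^+ (2 ^ l) = xi R k.
Proof.
elim: l => [|l IH]; first by rewrite addn0.
by rewrite addnS expnS exprM xiS_sqr.
Qed.

Lemma xi_root k : xi R k ^+ (2 ^ k) = 1.
Proof. by rewrite -[X in xi R X]add0n xiX_pow2 xi0. Qed.

Lemma xiS_half k : xi R k.+1 ^+ (2 ^ k) = -1.
Proof. by rewrite -add1n xiX_pow2 xi1. Qed.

Lemma norm_xi k : `|xi R k| = 1.
Proof.
apply/eqP; rewrite -(@pexpr_eq1 _ _ (2 ^ k)) ?expn_gt0 //.
by rewrite -normrX xi_root normr1.
Qed.

Lemma norm_xiz k (z : int) : `|xi R k ^ z| = 1.
Proof.
case: z => n; first by rewrite -exprnP normrX norm_xi expr1n.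
by rewrite NegzE -exprnN normfV normrX norm_xi expr1n invr1.
Qed.

Lemma xi_neq0 k : xi R k != 0.
Proof. by rewrite -normr_eq0 norm_xi oner_eq0. Qed.

(** The order divides [2 ^ k.+1], so it is a power of two; a proper divisor would divide [2 ^ k],
    although the [2 ^ k]-th power is -1. *)
Lemma xiS_primitive k : (2 ^ k.+1).-primitive_root (xi R k.+1).
Proof.
have [//|d prim_d] := prim_order_exists _ (xi_root k.+1).
  by rewrite expn_gt0.
move=> /(dvdn_pfactor _ _ (isT : prime 2)) [e le_e def_d].
move: prim_d; rewrite def_d; case: (ltngtP e k.+1) le_e => // [lt_e _|-> //].
move=> /prim_order_dvd/(_ (2 ^ k)%N); rewrite dvdn_exp2l // xiS_half => /esym.
by rewrite eq_sym -subr_eq0 opprK (_ : 1 + 1 = 2) // pnatr_eq0.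
Qed.

Lemma root_of_unity_xi k (x : C) :
  x ^+ (2 ^ k.+1) = 1 -> exists n : nat, x = xi R k.+1 ^+ n.
Proof. by move=> /(prim_rootP (xiS_primitive k)) [i ->]; exists i. Qed.

(** Exponents in [tau] are natural representatives of residues. Since the order of the root divides
    [2 ^ k], they can be replaced by integers, whose arithmetic does not depend on the level. *)
Lemma xi_intr k (z : int) :
  (0 < k)%N -> xi R k ^+ (z%:~R : 'Z_(2 ^ k)) = xi R k ^ z.
Proof.
move=> k_gt0; have lt1 : (1 < 2 ^ k)%N by rewrite -{1}(expn0 2) ltn_exp2l.
have xi_nat n : xi R k ^+ (n%:R : 'Z_(2 ^ k)) = xi R k ^+ n.
  by rewrite val_Zp_nat // expr_mod // xi_root.
case: z => n; first exact: xi_nat.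
rewrite NegzE; set x : 'Z_(2 ^ k) := _%:~R.
apply: (mulIf (expf_neq0 n.+1 (xi_neq0 k))); rewrite -exprD -xi_nat.
rewrite natrD natr_Zp /x mulrNz -pmulrn addNr expr0.
by rewrite -exprnN mulVf // expf_neq0 ?xi_neq0.
Qed.

Lemma norm1_conjV (x : C) : `|x| = 1 -> x^* = x^-1.
Proof. by move=> nx; rewrite invC_norm nx expr1n invr1 mul1r. Qed.


Variable m : nat.
Implicit Types (v w a b : 'rV['Z_2]_m) (f g : 'rV['Z_2]_m -> C).

(** * Monomial matrices and the Pauli group *)

Lemma addvv v : v + v = 0.
Proof.
apply/rowP=> l; rewrite !mxE; apply/val_inj.
by case: (v 0 l) => [[|[|//]]].
Qed.

Lemma addvK v w : v + w + w = v.
Proof. by rewrite -addrA addvv addr0. Qed.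

(* diag(f) X^a *)
Definition mono f a : qmx R m :=
  \matrix_(i, j) (f (label i) *+ (label j == label i + a)).

Lemma eq_mono f g a : f =1 g -> mono f a = mono g a.
Proof. by move=> fg; apply/matrixP=> i j; rewrite !mxE fg. Qed.

Lemma mono_entry f a v b :
  mono f a (enum_rank v) (enum_rank (v + b)) = f v *+ (b == a).
Proof. by rewrite mxE /label !enum_rankK (inj_eq (addrI v)). Qed.

Lemma mul_mono f g a b :
  mono f a *m mono g b = mono (fun v => f v * g (v + a)) (a + b).
Proof.
apply/matrixP=> i j; rewrite !mxE (bigD1 (enum_rank (label i + a))) //= !mxE.
rewrite /label enum_rankK eqxx mulr1n -mulrnAr addrA big1 ?addr0 // => k neq_k.
rewrite !mxE; case: eqP => [def_k|_]; last by rewrite mul0r.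
by case/eqP: neq_k; rewrite -def_k enum_valK.
Qed.

Lemma adj_mono f a :
  ((mono f a)^t*)%sesqui = mono (fun v => (f (v + a))^*) a.
Proof.
apply/matrixP=> i j; rewrite !mxE rmorphMn.
have -> : (label i == label j + a) = (label j == label i + a).
  by apply/eqP/eqP=> ->; rewrite addvK.
by case: eqP => [->|] //; rewrite addvK.
Qed.

Lemma mono1 : mono (fun=> 1) 0 = 1%:M.
Proof.
apply/matrixP=> i j; rewrite !mxE addr0 /label.
by rewrite (inj_eq enum_val_inj) eq_sym.
Qed.

Lemma scale_mono (c : C) f a : c *: mono f a = mono (fun v => c * f v) a.
Proof. by apply/matrixP=> i j; rewrite !mxE mulrnAr. Qed.

Lemma unitary_mono f a :
  (mono f a \is unitarymx) <-> (forall v, `|f v| = 1).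
Proof.
rewrite qualifE adj_mono mul_mono addvv -mono1; split=> [/eqP eq1 v|nf].
  have := congr1 (fun M : qmx R m => M (enum_rank v) (enum_rank (v + 0))) eq1.
  rewrite !mono_entry eqxx addvK -normCK => /eqP.
  by rewrite pexpr_eq1 // => /eqP.
by apply/eqP/eq_mono=> v; rewrite addvK -normCK nf expr1n.
Qed.

Definition chi b v : C := \prod_(l < m) (-1) ^+ (b 0%R l * v 0%R l)%N.

Lemma chiD b v w : chi b (v + w) = chi b v * chi b w.
Proof.
rewrite -big_split; apply: eq_bigr => l _ /=; rewrite mxE -exprD -mulnDr.
by case: (v 0 l) (w 0 l) => [[|[|//]] ?] [[|[|//]] ?];
  rewrite /= ?muln0 // mulnC exprM sqrrN !expr1n.
Qed.

Lemma chi0 v : chi 0 v = 1.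
Proof. by rewrite /chi big1 // => l _; rewrite mxE. Qed.

Lemma chi_sqr b v : chi b v ^+ 2 = 1.
Proof.
rewrite expr2 -chiD addvv /chi big1 // => l _.
by rewrite [X in (_ * nat_of_ord X)%N]mxE muln0.
Qed.

Lemma norm_chi b v : `|chi b v| = 1.
Proof. by apply/eqP; rewrite -(@pexpr_eq1 _ _ 2) // -normrX chi_sqr normr1. Qed.

Lemma pauliXZ_entry (a b x y : 'Z_2) :
  (pauliX R ^+ a *m pauliZ R ^+ b) x y = (-1) ^+ (b * y)%N *+ (y == x + a).
Proof.
have eX : pauliX R ^+ a = \matrix_(i, j) (j == i + a)%:R.
  apply/matrixP=> i j; case: a => [[|[|//]] lt_a]; rewrite ?expr0 ?expr1 !mxE;
    by case: i j => [[|[|//]] ?] [[|[|//]] ?].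
have eZ : pauliZ R ^+ b = \matrix_(i, j) ((-1) ^+ (b * j)%N *+ (i == j)).
  apply/matrixP=> i j; case: b => [[|[|//]] lt_b]; rewrite ?expr0 ?expr1 !mxE;
    by case: i j => [[|[|//]] ?] [[|[|//]] ?].
rewrite eX eZ mxE (bigD1 y) //= !mxE eqxx mulr1n mulrC mulr_natr.
by rewrite big1 ?addr0 // => k /negPf ne_k; rewrite !mxE ne_k mulr0n mulr0.
Qed.

(** The sign is read at [v + a] because Z^b stands to the right of X^a and so sees the column
    label. *)
Lemma D_mono a b : D R a b = mono (fun v => chi b (v + a)) a.
Proof.
apply/matrixP=> i j; rewrite !mxE.
under eq_bigr => l _ do rewrite pauliXZ_entry.
case: eqP => [->|ne]; first by apply: eq_bigr => l _; rewrite mxE eqxx.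
have [l ne_l] : exists l, label j 0 l != label i 0 l + a 0 l.
  apply/existsP; apply: contra_notT ne => /existsPn eq_ij.
  by apply/rowP=> l; rewrite mxE; apply/eqP/negbNE.
by rewrite (bigD1 l) //= (negPf ne_l) mul0r.
Qed.

(** The shift of the conjugate is [a + a' + a = a'], so the recursion defining the hierarchy stays
    within monomial matrices. *)
Lemma conj_D_mono f a a' b' :
  mono f a *m D R a' b' *m ((mono f a)^t*)%sesqui
  = mono (fun v => f v * (f (v + a'))^* * (chi b' (v + a') * chi b' a)) a'.
Proof.
have sumE v : v + a + a' = v + a' + a by rewrite addrAC.
rewrite D_mono adj_mono !mul_mono [a + a']addrC addvK.
by apply: eq_mono => v; rewrite addrA addvK sumE chiD; ring.
Qed.

(** * Integer quadratic forms on bit vectors *)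

Definition bit v (i : 'I_m) : int := (v 0 i : nat)%:Z.

Definition quad (T : 'M[int]_m) v : int :=
  \sum_i \sum_j T i j * bit v i * bit v j.

Lemma bitD v w i : bit (v + w) i = bit w i + (1 - 2 * bit w i) * bit v i.
Proof.
rewrite /bit mxE.
by case: (v 0 i) (w 0 i) => [[|[|//]] ?] [[|[|//]] ?].
Qed.

Lemma bit_idem v i : bit v i * bit v i = bit v i.
Proof. by rewrite /bit; case: (v 0 i) => [[|[|//]] ?]. Qed.

Lemma quadD (S T : 'M[int]_m) v : quad (S + T) v = quad S v + quad T v.
Proof.
rewrite -big_split; apply: eq_bigr => i _; rewrite -big_split.
by apply: eq_bigr => j _; rewrite mxE !mulrDl.
Qed.

Lemma quad_diag (d : 'rV[int]_m) v : quad (diag_mx d) v = \sum_i d 0 i * bit v i.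
Proof.
apply: eq_bigr => i _; rewrite (bigD1 i) //= big1 ?addr0; last first.
  by move=> j /negPf ne_ji; rewrite mxE eq_sym ne_ji !mul0r.
by rewrite mxE eqxx mulr1n -mulrA bit_idem.
Qed.

(* Modulo 2 the off-diagonal terms of a symmetric form cancel in pairs. *)
Lemma quad_sym_split (T : 'M[int]_m) v : T^T = T ->
  exists z, quad T v = \sum_i T i i * bit v i + 2 * z.
Proof.
move=> symT; pose F i j := T i j * bit v i * bit v j.
exists (\sum_(i < m) \sum_(j < m | (i < j)%N) F i j).
have -> : quad T v
  = \sum_(i < m) (T i i * bit v i + \sum_(j < m | (i < j)%N) F i j)
    + \sum_(i < m) \sum_(j < m | (j < i)%N) F i j.
  rewrite -big_split; apply: eq_bigr => i _ /=.
  rewrite (bigD1 i) //= -[_ * _ * bit v i]mulrA bit_idem -addrA; congr (_ + _).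
  rewrite (bigID (fun j : 'I_m => (i < j)%N)) /=.
  congr (_ + _); apply: eq_bigl => j; rewrite -val_eqE /=; by case: ltngtP.
rewrite big_split -addrA; congr (_ + _).
rewrite [X in _ + X](exchange_big_dep predT) //= mulr_natl mulr2n; congr (_ + _).
apply: eq_bigr => i _; apply: eq_bigr => j _.
by rewrite /F -{1}symT mxE mulrAC.
Qed.

(** Half of the non-constant part of [quad T v - quad T (v + a)]; its linear terms sit on the
    diagonal, bits being idempotent. *)
Definition polarize (T : 'M[int]_m) a : 'M[int]_m :=
  \matrix_(i, j) ((bit a i + bit a j - 2 * bit a i * bit a j) * T i j)
  - diag_mx (\row_j ((1 - 2 * bit a j) * \sum_i T i j * bit a i)).

Lemma polarize_sym (T : 'M[int]_m) a : T^T = T -> (polarize T a)^T = polarize T a.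
Proof.
move=> symT; rewrite linearB /= tr_diag_mx; congr (_ - _).
by apply/matrixP=> i j; rewrite !mxE -{1}symT mxE; ring.
Qed.

(* With bit (v + a) i = a_i + s_i v_i, s_i = 1 - 2 a_i, everything non-constant
   is even since 1 - s_i s_j = 2 (a_i + a_j - 2 a_i a_j). *)
Lemma quad_shift (T : 'M[int]_m) v a : T^T = T ->
  quad T v - quad T (v + a) = 2 * quad (polarize T a) v - quad T a.
Proof.
move=> symT; rewrite /polarize quadD -scaleN1r.
have -> (d : 'rV[int]_m) : quad (-1 *: diag_mx d) v = - \sum_i d 0 i * bit v i.
  rewrite -quad_diag /quad -sumrN; apply: eq_bigr => i _; rewrite -sumrN.
  by apply: eq_bigr => j _; rewrite mxE -!mulrA mulN1r.
have -> : \sum_j (\row_j ((1 - 2 * bit a j) * \sum_i T i j * bit a i)) 0 j * bit v j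
   = \sum_i \sum_j T i j * bit a i * (1 - 2 * bit a j) * bit v j.
  rewrite exchange_big; apply: eq_bigr => j _ /=; rewrite mxE mulr_sumr mulr_suml.
  by apply: eq_bigr => i _; ring.
(* Symmetrising the linear part makes the final identity hold term by term in [(i, j)]. *)
set L := \sum_i _; have L2 : L + L = \sum_i \sum_j T i j *
    (bit a i * (1 - 2 * bit a j) * bit v j + bit a j * (1 - 2 * bit a i) * bit v i).
  rewrite {2}/L exchange_big -big_split; apply: eq_bigr => i _; rewrite -big_split.
  by apply: eq_bigr => j _ /=; rewrite -{2}symT mxE; ring.
rewrite mulrBr [2 * L]mulr_natl [L *+ 2]mulr2n L2 /quad mulr_sumr -!sumrN -!big_split.
apply: eq_bigr => i _ /=; rewrite mulr_sumr -!sumrN -!big_split.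
apply: eq_bigr => j _ /=; rewrite !bitD !mxE; ring.
Qed.

(** As -1 is the [2 ^ k]-th power of [xi R k.+1], the Pauli signs can be absorbed into the quadratic
    form at every level. *)
Lemma chi_xi k b v :
  chi b v = xi R k.+1 ^ quad (diag_mx (\row_i (2 ^+ k * bit b i))) v.
Proof.
rewrite quad_diag (big_morph _ (fun x y => expfzDr x y (xi_neq0 k.+1)) (expr0z _)).
apply: eq_bigr => i _; rewrite mxE /bit -mulrA -PoszM.
by rewrite -natrX natz -PoszM -exprnP [RHS]exprM xiS_half.
Qed.

(** * Monomial matrices in the Clifford hierarchy *)

(** The shift [a] and the phase [c] are there for the induction, since conjugates carry both. Only
    level 1 restricts [c], Pauli phases being powers of i; higher up [c] cancels in the ratio. *)
Lemma clifford_quad k (T : 'M[int]_m) (c : C) a :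
  T^T = T -> `|c| = 1 -> (k = 0%N -> c ^+ 4 = 1) ->
  clifford k.+1 (mono (fun v => c * xi R k.+1 ^ quad T v) a).
Proof.
elim: k T c a => [|k IH] T c a symT nc c4.
  (* Modulo 2 a symmetric form is the linear form of its diagonal, which gives the Z-part. The
     factor [chi b a] below offsets the shift in the sign of [D]. *)
  pose b : 'rV['Z_2]_m := \row_i (T i i)%:~R.
  have [n def_n] : exists n, c * chi b a = xi R 2 ^+ n.
    apply: root_of_unity_xi.
    by rewrite exprMn c4 // mul1r (exprM _ 2 2) chi_sqr expr1n.
  exists n%:R, a, b; rewrite D_mono scale_mono; apply: eq_mono => v.
  rewrite -xi2 (xi_intr n (isT : (0 < 2)%N)) -exprnP -def_n chiD mulrACA mulrC.
  rewrite -!mulrA -expr2 chi_sqr mulr1 mulrC; congr (_ * _).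
  rewrite (chi_xi 0) -!xi_intr //; congr (_ ^+ (nat_of_ord _)).
  have [z ->] := quad_sym_split v symT.
  have two0 : (2 : int)%:~R = 0 :> 'Z_(2 ^ 1) by apply: val_inj.
  rewrite quad_diag intrD intrM two0 mul0r addr0.
  rewrite !rmorph_sum; apply: eq_bigr => i _.
  by rewrite !mxE /= expr0 mul1r !intrM -!pmulrn !mxE !natr_Zp.
split; first by apply/unitary_mono => v; rewrite normrM nc mul1r norm_xiz.
move=> a' b'; rewrite conj_D_mono.
set T' := polarize T a' + diag_mx (\row_i (2 ^+ k * bit b' i)).
pose c' := xi R k.+2 ^ (- quad T a') * (chi b' a' * chi b' a).
rewrite (@eq_mono _ (fun v => c' * xi R k.+1 ^ quad T' v)).
  apply: IH.
  - by rewrite linearD /= polarize_sym // tr_diag_mx.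
  - by rewrite !normrM norm_xiz !norm_chi !mulr1.
  (* When the next level is the first, [c'] is a sign times a power of [xi R 2], hence a fourth root
     of unity. *)
  move=> k0; rewrite /c' k0 !exprMn !(exprM _ 2 2) !chi_sqr !expr1n !mulr1.
  by rewrite -exprM exprnP exprzAC -exprnP (xi_root 2) exp1rz.
move=> v; rewrite norm1_conjV; last by rewrite normrM nc mul1r norm_xiz.
have key : xi R k.+2 ^ quad T v / xi R k.+2 ^ quad T (v + a')
    = xi R k.+2 ^ (- quad T a') * xi R k.+1 ^ quad (polarize T a') v.
  rewrite invr_expz -expfzDr ?xi_neq0 // quad_shift // addrC.
  by rewrite expfzDr ?xi_neq0 // -[xi R k.+1]xiS_sqr (exprnP _ 2) exprz_exp.
have AC (x y z s t : C) : x * y * (z * s * t) = x * (s * t) * (y * z) by ring.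
have cancel x y : c * x / (c * y) = x / y.
  by rewrite -mulf_div divff ?mul1r // -normr_eq0 nc oner_eq0.
rewrite quadD expfzDr ?xi_neq0 //.
by rewrite -chi_xi chiD /c' cancel [X in X * _]key AC.
Qed.

(** Pauli entries are fourth roots of unity, and each level doubles the exponent. Powers are only
    compared with each other because a global phase stays free above level 1. *)
Lemma clifford_mono_root k f a : clifford k.+1 (mono f a) ->
  (forall v, `|f v| = 1) /\ (forall v w, f v ^+ (2 ^ k.+2) = f w ^+ (2 ^ k.+2)).
Proof.
elim: k f a => [|k IH] f a.
  move=> [kappa [a' [b]]]; rewrite D_mono scale_mono => eqU.
  have f4 v : f v ^+ 4 = 1.
    (* The Pauli side is nonzero at this entry, which excludes [a' <> a]. *)
    have := congr1 (fun M : qmx R m => M (enum_rank v) (enum_rank (v + a'))) eqU.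
    rewrite !mono_entry eqxx mulr1n; case: eqP => _.
      rewrite mulr1n => ->; rewrite exprMn exprAC -xi2 (xi_root 2) expr1n mul1r.
      by rewrite (exprM _ 2 2) chi_sqr expr1n.
    move=> /esym/eqP; rewrite -normr_eq0 normrM norm_chi mulr1 normrX -xi2 norm_xi.
    by rewrite expr1n oner_eq0.
  split=> [v|v w]; last by rewrite !f4.
  by apply/eqP; rewrite -(@pexpr_eq1 _ _ 4) // -normrX f4 normr1.
move=> [/unitary_mono nf Cf]; split=> // v w.
(* The shift [v + w] exchanges [v] and [w], so the induction hypothesis equates a power of
   [f v / f w] with its inverse. *)
have := Cf (v + w) 0; rewrite conj_D_mono => /IH [_ /(_ v w)].
rewrite addrA addvv add0r [w + (v + w)]addrC addvK !chi0 !mulr1.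
rewrite !norm1_conjV // !expr_div_n => /eqP.
have f_neq0 u : f u != 0 by rewrite -normr_eq0 nf oner_eq0.
by rewrite eqr_div ?expf_neq0 // -!expr2 -!exprM -!expnSr => /eqP.
Qed.

Lemma tau_mono k (T : 'M[int]_m) : (0 < k)%N ->
  tau R (map_mx intr T : 'M['Z_(2 ^ k)]_m) = mono (fun v => xi R k ^ quad T v) 0.
Proof.
move=> k_gt0; apply/matrixP=> i j; rewrite summxE (bigD1 (label i)) //= big1.
  rewrite !mxE /label enum_valK eqxx addr0 addr0 (inj_eq enum_val_inj) mulr_natr.
  rewrite -xi_intr //; congr (_ ^+ nat_of_ord _ *+ _).
  rewrite /qform /quad mxE [in RHS]exchange_big /= rmorph_sum; apply: eq_bigr => k' _ /=.
  rewrite mxE mulr_suml rmorph_sum; apply: eq_bigr => l _ /=.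
  by rewrite !mxE /bit !intrM -!pmulrn; ring.
move=> v ne_v; rewrite !mxE [i == _](_ : _ = false) ?mulr0 //.
by apply: contraNF ne_v => /eqP ->; rewrite /label enum_rankK.
Qed.

(** * Tensor products over blocks of qubits *)

Definition unit_label (i : 'I_m) : 'rV['Z_2]_m := delta_mx 0 i.

Definition block_mask (B : {set 'I_m}) v : 'rV['Z_2]_m :=
  \row_i (if i \in B then v 0 i else 0).

Lemma quad_blocks (P : {set {set 'I_m}}) (T : 'M[int]_m) v :
  partition P [set: 'I_m] ->
  (forall i j, pblock P i != pblock P j -> T i j = 0) ->
  quad T v = \sum_(B in P) \sum_(i in B) \sum_(j in B) T i j * bit v i * bit v j.
Proof.
move=> partP T0;
rewrite /quad (eq_bigl (fun i => i \in [set: 'I_m])) => [|i]; last by rewrite inE.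
rewrite (set_partition_big _ partP).
have /and3P [_ tiP _] := partP.
apply: eq_bigr => B PB; apply: eq_bigr => i Bi.
rewrite (bigID (mem B)) /= [X in _ + X]big1 ?addr0 // => j nBj.
rewrite T0 ?mul0r // (def_pblock tiP PB Bi).
apply: contraNneq nBj => ->; rewrite mem_pblock.
by rewrite (cover_partition partP).
Qed.

Lemma restrict_mask (B : {set 'I_m}) v :
  Defs.restrict B (block_mask B v) = Defs.restrict B v.
Proof. by apply/rowP=> l; rewrite !mxE enum_valP. Qed.

Lemma restrict_mask0 (B B' : {set 'I_m}) v :
  [disjoint B & B'] -> Defs.restrict B' (block_mask B v) = Defs.restrict B' 0.
Proof.
move=> dis; apply/rowP=> l; rewrite !mxE ifN //.
by rewrite (disjointFl dis) // enum_valP.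
Qed.

(* A product over the blocks is recovered, once normalised at 0, from its
   values at the labels supported on a single block. *)
Lemma block_product_mask (P : {set {set 'I_m}})
    (h : forall B : {set 'I_m}, 'rV['Z_2]_#|B| -> C) f v :
  trivIset P -> (forall v, f v = \prod_(B in P) h B (Defs.restrict B v)) ->
  f 0 != 0 -> f v / f 0 = \prod_(B in P) (f (block_mask B v) / f 0).
Proof.
move=> tiP fE nz; have nzB B : B \in P -> h B (Defs.restrict B 0) != 0.
  by move=> PB; move: nz; rewrite fE => /prodf_neq0/(_ B PB).
rewrite !(fE v) (fE 0) -prodf_div; apply: eq_bigr => B PB.
rewrite fE (bigD1 B) // [X in _ = _ / X](bigD1 B) //= restrict_mask.
rewrite [X in _ = _ * X / _](eq_bigr (fun B' => h B' (Defs.restrict B' 0))).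
  rewrite -mulf_div divff ?mulr1 //.
  by apply/prodf_neq0 => B' /andP [PB' _]; exact: nzB.
move=> B' /andP [PB' ne_B]; rewrite restrict_mask0 //.
by apply: (trivIsetP tiP) => //; rewrite eq_sym.
Qed.

(** Distinct labels differ at some qubit, and the factor of its block is then an off-diagonal entry,
    hence zero. *)
Lemma tensor_blocks_mono (P : {set {set 'I_m}})
    (W : forall B : {set 'I_m}, qmx R #|B|) :
  partition P [set: 'I_m] -> {in P, forall B, is_diag_mx (W B)} ->
  tensor_blocks P W = mono (fun v => \prod_(B in P)
    W B (enum_rank (Defs.restrict B v)) (enum_rank (Defs.restrict B v))) 0.
Proof.
move=> partP diagW; apply/matrixP=> i j; rewrite !mxE addr0.
case: eqP => [-> //|ne]; have [l ne_l] : exists l, label j 0 l != label i 0 l.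
  apply/existsP; apply: contra_notT ne => /existsPn eq_ij.
  by apply/rowP=> l; apply/eqP/negbNE.
have Pl : pblock P l \in P by rewrite pblock_mem // (cover_partition partP).
have lB : l \in pblock P l by rewrite mem_pblock (cover_partition partP).
rewrite mulr0n (bigD1 (pblock P l)) //= (is_diag_mxP (diagW _ Pl)) ?mul0r //.
rewrite val_eqE (inj_eq enum_rank_inj); apply: contra ne_l => /eqP.
move=> /rowP/(_ (enum_rank_in lB l)); rewrite !mxE enum_rankK_in // => ->.
exact: eqxx.
Qed.

(* The factor 2 makes room for odd pair couplings: at level k.+2 the (i, j)
   and (j, i) entries together contribute twice the coupling. *)
Definition phase_form (P : {set {set 'I_m}}) (n : 'rV['Z_2]_m -> int) :=
  \matrix_(i, j) (if pblock P i != pblock P j then 0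
    else if i == j then 2 * n (unit_label i)
    else n (unit_label i + unit_label j) - n (unit_label i) - n (unit_label j)).

Lemma phase_form_sym P n : (phase_form P n)^T = phase_form P n.
Proof.
apply/matrixP=> i j; rewrite !mxE eq_sym [j == i]eq_sym.
case: eqP => //= _; case: eqP => [-> //|_]; rewrite [unit_label j + _]addrC.
ring.
Qed.

(** Interpolation on at most two bits: the coefficients match [2 * n] at the unit labels and their
    sum, and [n 0 = 0] covers the zero label. *)
Lemma phase_form_block P n (B : {set 'I_m}) v :
  trivIset P -> B \in P -> #|B| = 1%N \/ #|B| = 2%N -> n 0 = 0 ->
  \sum_(i in B) \sum_(j in B) phase_form P n i j * bit v i * bit v j
  = 2 * n (block_mask B v).
Proof.
move=> tiP PB cB n0.
have same i j : i \in B -> j \in B -> pblock P i == pblock P j.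
  by move=> Bi Bj; rewrite !(def_pblock tiP PB).
have bitE i : (v 0 i = 0 /\ bit v i = 0) \/ (v 0 i = 1 /\ bit v i = 1).
  rewrite /bit; case: (v 0 i) => [[|[|//]] lt_x]; [left|right];
    by split=> //; apply/val_inj.
case: cB => [/eqP/cards1P [i defB]|/eqP/cards2P [i [j [ne_ij defB]]]].
  have maskE : block_mask B v = v 0 i *: unit_label i.
    apply/rowP=> l; rewrite defB !mxE inE; case: eqP => [->|_] /=.
      by rewrite mulr1.
    by rewrite mulr0.
  rewrite maskE defB !big_set1 mxE !eqxx /=.
  by case: (bitE i) => [[-> ->]|[-> ->]]; rewrite ?scale0r ?scale1r ?n0; ring.
have maskE : block_mask B v = v 0 i *: unit_label i + v 0 j *: unit_label j.
  apply/rowP=> l; rewrite defB !mxE !inE; case: (eqVneq l i) => [->|_] /=.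
    by rewrite (negPf ne_ij) mulr1 mulr0 addr0.
  by case: (eqVneq l j) => [->|_] /=; rewrite ?mulr1 ?mulr0 add0r.
have Bi : i \in B by rewrite defB !inE eqxx.
have Bj : j \in B by rewrite defB !inE eqxx orbT.
rewrite maskE defB !big_setU1 ?inE //= !big_set1 !big_setU1 ?inE //= !big_set1.
rewrite !mxE !same // !eqxx [j == i]eq_sym (negPf ne_ij) /=.
rewrite [unit_label j + _]addrC.
case: (bitE i) => [[-> ->]|[-> ->]]; case: (bitE j) => [[-> ->]|[-> ->]];
  rewrite ?scale0r ?scale1r ?addr0 ?add0r ?n0; ring.
Qed.

End DiagonalClifford.

Theorem theorem7 (R : realType) (m : nat) (hm : (1 <= m)%N) :
  (forall (k : nat) (S : 'M['Z_(2 ^ k)]_m),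
     (1 <= k)%N -> S^T = S -> clifford_diag k (tau R S))
  /\
  (forall U : qmx R m,
     two_local_diag_unitary U ->
     (exists2 j : nat, (1 <= j)%N & clifford j U) ->
     exists (k : nat) (S : 'M['Z_(2 ^ k)]_m) (c : complex R),
       [/\ (1 <= k)%N, S^T = S, `|c| = 1 & U = c *: tau R S]).
Proof.
split=> [[//|k] S _ symS|U [P [W [partP cardP diagW ->]]] [[//|j] _ CU]].
  (* Lifting by canonical representatives preserves symmetry. *)
  pose T := map_mx (fun x : 'Z_(2 ^ k.+1) => (x : nat)%:Z) S.
  have -> : S = map_mx intr T by apply/matrixP=> i j; rewrite !mxE -pmulrn natr_Zp.
  rewrite tau_mono //; split.
    rewrite (@eq_mono _ _ _ (fun v => 1 * xi R k.+1 ^ quad T v)); last first.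
      by move=> v; rewrite mul1r.
    apply: clifford_quad; rewrite ?normr1 ?expr1n //.
    by rewrite /T map_trmx symS.
  apply/is_diag_mxP=> i j ne_ij; rewrite mxE addr0 /label (inj_eq enum_val_inj).
  by rewrite eq_sym -val_eqE (negPf ne_ij).
have /and3P [_ tiP _] := partP.
rewrite tensor_blocks_mono in CU *; [|by []|by move=> B /diagW []..].
set u := fun v => _ in CU *.
have [nu uM] := clifford_mono_root CU.
have u_neq0 v : u v != 0 by rewrite -normr_eq0 nu oner_eq0.
have root_u v : exists n : nat, u v / u 0 == xi R j.+2 ^+ n.
  have [|n ->] := @root_of_unity_xi R j.+1 (u v / u 0); last by exists n.
  by rewrite expr_div_n (uM v 0) divff // expf_neq0.
(* The value at 0 is imposed, since the chosen exponent could be a nonzero multiple of the order. *)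
pose n v := (if v == 0 then 0 else xchoose (root_u v) : int).
have nE v : u v / u 0 = xi R j.+2 ^ n v.
  rewrite /n; case: eqP => [->|_]; first by rewrite divff ?expr0z.
  exact/eqP/(xchooseP (root_u v)).
pose T := phase_form P n.
(* The ratios are powers of [xi R j.+2]; one more level compensates for the factor 2 in
   [phase_form]. *)
exists j.+3, (map_mx intr T), (u 0); split=> //.
  by rewrite map_trmx phase_form_sym.
rewrite tau_mono // scale_mono; apply: eq_mono => v.
apply: (mulIf (invr_neq0 (u_neq0 0))); rewrite [RHS]mulrAC divff // mul1r.
rewrite (@block_product_mask _ _ P
  (fun B w => W B (enum_rank w) (enum_rank w))) //.
rewrite (quad_blocks _ partP); last first.
  by move=> i l ne; rewrite mxE ne.
rewrite (big_morph _ (fun x y => expfzDr x y (xi_neq0 R j.+3)) (expr0z _)).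
apply: eq_bigr => B PB; rewrite nE phase_form_block //; last by rewrite /n eqxx.
  by rewrite -[xi R j.+2]xiS_sqr (exprnP _ 2) exprz_exp.
exact: cardP.
Qed.
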